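(* Let $G$ be a finite simple graph on $n$ vertices, and let $\gamma(G)$ be its domination number. Then $$\min(s^+(G), s^-(G)) \geq n - \gamma(G).$$
   Context: For a finite simple graph $G$ with adjacency matrix $A_G$ having eigenvalues $\lambda_1 \geq \cdots \geq \lambda_n$, the positive square energy is $s^+(G) = \sum_{i:\lambda_i \geq 0} \lambda_i^2$ and the negative square energy is $s^-(G) = \sum_{i:\lambda_i \leq 0} \lambda_i^2$. A dominating set of $G$ is a set $D$ of vertices such that every vertex lies in $D$ or is adjacent to a vertex of $D$; $\gamma(G)$ is the minimum size of a dominating set. *)

(* Defs.v *)
From mathcomp Require Import all_boot all_order all_algebra.
From mathcomp Require Import polyrcf reals.

Set Implicit Arguments.
Unset Strict Implicit.
Unset Printing Implicit Defensive.

Import Order.TTheory GRing.Theory Num.Theory.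
Local Open Scope ring_scope.

Definition adjmx (R : realType) (T : finType) (adj : rel T) : 'M[R]_#|T| :=
  \matrix_(i, j) (adj (enum_val i) (enum_val j))%:R.

(* The real eigenvalues in nonincreasing order, each repeated according to its
   algebraic multiplicity; [rootsR p] lists the distinct roots of p != 0 in
   increasing order.  For symmetric A these are all n eigenvalues of A. *)
Definition eigenvalues (R : realType) (n : nat) (A : 'M[R]_n) : seq R :=
  flatten [seq nseq (mup x (char_poly A)) x | x <- rev (rootsR (char_poly A))].

Definition pos_square_energy (R : realType) (T : finType) (adj : rel T) : R :=
  \sum_(x <- eigenvalues (adjmx R adj) | 0 <= x) x ^+ 2.

Definition neg_square_energy (R : realType) (T : finType) (adj : rel T) : R :=
  \sum_(x <- eigenvalues (adjmx R adj) | x <= 0) x ^+ 2.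

Definition dominating (T : finType) (adj : rel T) (D : {set T}) : bool :=
  [forall v, (v \in D) || [exists u in D, adj v u]].

Lemma dominating_setT (T : finType) (adj : rel T) : dominating adj [set: T].
Proof. by apply/forallP => v; rewrite inE. Qed.

(* [arg min] returns its default [set: T] only if the predicate fails there,
   which [dominating_setT] rules out. *)
Definition domination_number (T : finType) (adj : rel T) : nat :=
  #|[arg min_(D < [set: T] | dominating adj D) #|D|]|.

Lemma domination_numberP (T : finType) (adj : rel T) :
  (exists2 D : {set T}, dominating adj D & #|D| = domination_number adj) /\
  (forall D : {set T}, dominating adj D -> (domination_number adj <= #|D|)%N).
Proof.
rewrite /domination_number; case: arg_minnP => [|D domD minD].
  exact: dominating_setT.
by split; first exists D.
Qed.

Lemma count_eigenvalues (R : realType) (n : nat) (A : 'M[R]_n) (x : R) :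
  count_mem x (eigenvalues A) = mup x (char_poly A).
Proof.
have p0 : char_poly A != 0 by rewrite monic_neq0 ?char_poly_monic.
rewrite count_flatten -map_comp sumnE big_map.
under eq_bigr => y _ do rewrite /= count_nseq /= eq_sym.
have [rx|nrx] := boolP (root (char_poly A) x); last first.
  rewrite mupNroot // big1_seq // => y /andP[_].
  rewrite mem_rev -roots_on_rootsR // => /andP[_ ry].
  by case: eqP ry nrx => [->|//] ->.
have rin : x \in rev (rootsR (char_poly A)).
  by rewrite mem_rev -roots_on_rootsR.
rewrite (bigD1_seq x) ?rev_uniq ?uniq_roots //= eqxx mul1n big1 ?addn0 //.
by move=> y; rewrite eq_sym => /negPf ->.
Qed.

Lemma mem_eigenvalues (R : realType) (n : nat) (A : 'M[R]_n) (x : R) :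
  (x \in eigenvalues A) = eigenvalue A x.
Proof.
have p0 : char_poly A != 0 by rewrite monic_neq0 ?char_poly_monic.
rewrite eigenvalue_root_char -has_pred1 has_count count_eigenvalues.
by rewrite -XsubC_dvd // dvdp_XsubCl.
Qed.

Lemma sorted_eigenvalues (R : realType) (n : nat) (A : 'M[R]_n) :
  sorted >=%R (eigenvalues A).
Proof.
rewrite /eigenvalues.
have : sorted >%R (rev (rootsR (char_poly A))) by rewrite rev_sorted sorted_roots.
elim: (rev _) => //= y s IHs; rewrite (path_sortedE (rev_trans lt_trans)).
move=> /andP[/allP ys /IHs s_sorted].
have tr : transitive (>=%R : rel R) by apply: rev_trans le_trans.
rewrite (sorted_pairwise tr) pairwise_cat -!(sorted_pairwise tr) s_sorted andbT.
apply/andP; split.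
  apply/allrelP => _ z /nseqP[-> _] /flatten_mapP[t ts /nseqP[-> _]].
  exact/ltW/ys.
by elim: (mup _ _) => //= k; case: k => //= k ->; rewrite lexx.
Qed.

(* Main.v *)
Require Import Defs.
From mathcomp Require Import all_boot all_order all_algebra.
From mathcomp Require Import reals complex.
From mathcomp Require Import ring lra.

(** The negative square energy is the squared Frobenius distance from the
    adjacency matrix A to the positive semidefinite cone (and the positive one
    that of -A), so it is enough to bound |A - B|^2 and |A + B|^2 from below for
    every positive semidefinite B.  Such squared norms only decrease when the
    entries are restricted to diagonal blocks; assigning every vertex to a
    dominator splits G into gamma blocks with a universal vertex, and a block
    with m + 1 vertices has to contribute at least m.

    For |A + B|^2 the eigenvector of the spanning star gives this.  For
    |A - B|^2 argue by induction on m, with H the block minus its universal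
    vertex.  If H contains an induced path on three vertices, positivity of B on
    the path forces one of them to account for at least 1 in |A - B|^2, and that
    vertex is deleted.  Otherwise H is a disjoint union of cliques, and an
    explicit dual witness Y >= 0 gives |A - B|^2 >= - 2 <A, Y> - |Y|^2 >= m. *)

Set Implicit Arguments.
Unset Strict Implicit.
Unset Printing Implicit Defensive.

Import Order.TTheory GRing.Theory Num.Theory.
Local Open Scope ring_scope.
Local Open Scope sesquilinear_scope.

(** * Positive semidefinite kernels and induced paths *)

Definition psd_kernel (R : numDomainType) (T : finType) (B : T -> T -> R) :=
  (forall i j, B i j = B j i) /\
  (forall c : T -> R, 0 <= \sum_i \sum_j c i * c j * B i j).

Section Kernel.
Context {R : realFieldType} {T : finType}.
Implicit Types (B F : T -> T -> R) (S : {set T}) (v i j k : T).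

Lemma sum2_setU1 F v S : (forall i j, F i j = F j i) -> v \notin S ->
  \sum_(i in v |: S) \sum_(j in v |: S) F i j =
  F v v + 2 * \sum_(j in S) F v j + \sum_(i in S) \sum_(j in S) F i j.
Proof.
move=> Fsym vS; rewrite big_setU1 //= big_setU1 //=.
under [X in _ + X]eq_bigr => i _ do rewrite big_setU1 //= Fsym.
by rewrite big_split /=; ring.
Qed.

Lemma psd_kernel_in B S (c : T -> R) : psd_kernel B ->
  0 <= \sum_(i in S) \sum_(j in S) c i * c j * B i j.
Proof.
case=> _ /(_ (fun i => if i \in S then c i else 0)) /le_trans; apply.
rewrite le_eqVlt; apply/orP; left; apply/eqP.
rewrite [RHS]big_mkcond; apply: eq_bigr => i _; case: ifP => iS; last first.
  by apply: big1 => j _; rewrite !mul0r.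
rewrite [RHS]big_mkcond; apply: eq_bigr => j _; case: ifP => // jS.
by rewrite mulr0 mul0r.
Qed.

Lemma psd_kernel_diag2 B i j : psd_kernel B -> 0 <= B i i + B j j - 2 * B i j.
Proof.
move=> psdB; have [->|ij] := eqVneq i j; first by lra.
have := @psd_kernel_in B (i |: [set j]) (fun k => if k == i then 1 else -1) psdB.
rewrite sum2_setU1 ?inE //; last by move=> ? ?; rewrite psdB.1; ring.
by rewrite !big_set1 eqxx eq_sym (negPf ij); move/le_trans; apply; lra.
Qed.

(** The test vector is (1, -s, 1) along the path; s stays free so that it can be optimised once
    [B j j] is known. *)
Lemma psd_kernel_path3 B i j k (s : R) : psd_kernel B ->
  i != j -> j != k -> i != k ->
  0 <= B i i + B k k + 2 * B i k + s ^+ 2 * B j j - 2 * s * (B i j + B j k).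
Proof.
move=> psdB ij jk ik.
have := @psd_kernel_in B (i |: (j |: [set k]))
  (fun l => if l == j then - s else 1) psdB.
have symc l1 l2 : (if l1 == j then - s else 1) * (if l2 == j then - s else 1)
    * B l1 l2 = (if l2 == j then - s else 1) * (if l1 == j then - s else 1)
    * B l2 l1 by rewrite psdB.1; ring.
rewrite !sum2_setU1 ?inE ?negb_or ?ij //.
rewrite big_setU1 ?inE //= !big_set1 !eqxx (negPf ij) eq_sym (negPf jk).
by move/le_trans; apply; lra.
Qed.

Lemma ge2_sum S (f : T -> R) i j : (forall k, 0 <= f k) ->
  i \in S -> j \in S -> i != j -> f i + f j <= \sum_(k in S) f k.
Proof.
move=> f0 iS jS ij; rewrite (bigD1 i) //= (bigD1 j) ?jS 1?eq_sym //= addrA.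
by rewrite lerDl sumr_ge0.
Qed.
End Kernel.

(* The kernel restricted to an induced path has diagonal (p, q, r), entries x, z
   on its edges and w on the non-edge; the alternatives bound from below what
   deleting the first, second or third vertex removes from the defect.  If all
   failed, then with 2 S = x + z, 2 P = p + r and d = 1 - S, positivity would
   give 2 (1 - d)^2 <= (P + w) q <= (P + w)^2 / 3 + 3 q^2 / 4 < 5 / 4 - 4 d^2,
   although 6 d^2 - 4 d + 3 / 4 has no real root. *)
Lemma path3_gain (R : realFieldType) (p q r x z w : R) :
  (forall s, 0 <= p + r + 2 * w + s ^+ 2 * q - 2 * s * (x + z)) -> 0 <= q ->
  [\/ 1 <= p ^+ 2 + 2 * ((1 - x) ^+ 2 + (0 - w) ^+ 2),
      1 <= q ^+ 2 + 2 * ((1 - x) ^+ 2 + (1 - z) ^+ 2) |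
      1 <= r ^+ 2 + 2 * ((0 - w) ^+ 2 + (1 - z) ^+ 2)].
Proof.
move=> disc q0.
have [|Hp] := lerP 1 (p ^+ 2 + 2 * ((1 - x) ^+ 2 + (0 - w) ^+ 2)); first by constructor 1.
have [|Hq] := lerP 1 (q ^+ 2 + 2 * ((1 - x) ^+ 2 + (1 - z) ^+ 2)); first by constructor 2.
have [|Hr] := lerP 1 (r ^+ 2 + 2 * ((0 - w) ^+ 2 + (1 - z) ^+ 2)); first by constructor 3.
exfalso; pose S := (x + z) / 2; pose P := (p + r) / 2; pose d := 1 - S.
have HP : P ^+ 2 + 2 * d ^+ 2 + 2 * w ^+ 2 < 1.
  have := sqr_ge0 (p - r); have := sqr_ge0 (x - z); rewrite /P /d /S; nra.
have HQ : q ^+ 2 + 4 * d ^+ 2 < 1.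
  have := sqr_ge0 (x - z); rewrite /d /S; nra.
have HS : 2 * S ^+ 2 <= (P + w) * q.
  have [q_eq0|qn0] := eqVneq q 0.
    (* For q = 0 the form is affine in s, so x + z = 0: otherwise this s gives the value -(p + r +
       2w) - 2, negative by [disc 0]. *)
    have := disc ((p + r + 2 * w + 1) / (x + z)); rewrite q_eq0.
    have [S0|Sn0] := eqVneq (x + z) 0; first by move=> _; rewrite /S S0; lra.
    rewrite mulr0 addr0 -mulrA divfK //; have := disc 0; lra.
  have qp : 0 < q by rewrite lt_def qn0.
  have := disc ((x + z) / q).
  have -> : p + r + 2 * w + ((x + z) / q) ^+ 2 * q - 2 * ((x + z) / q) * (x + z)
     = (2 * (P + w) * q - 4 * S ^+ 2) / q by rewrite /P /S; field.
  rewrite pmulr_lge0 ?invr_gt0 //; lra.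
have HAM : (P + w) * q <= (P + w) ^+ 2 / 3 + 3 / 4 * q ^+ 2.
  have := sqr_ge0 (2 * (P + w) - 3 * q); nra.
have HPw : (P + w) ^+ 2 <= 3 / 2 * (P ^+ 2 + 2 * w ^+ 2).
  have := sqr_ge0 (P - 2 * w); nra.
(* The quadratic 6 d^2 - 4 d + 3/4 is minimal at d = 1/3, with value 1/12. *)
have := sqr_ge0 (d - 1 / 3); have : S = 1 - d by rewrite /d; ring.
by move=> eS; rewrite eS in HS; nra.
Qed.

(** * Cones over disjoint unions of cliques *)

Section DisjointCliques.
Context {R : rcfType} {T : finType}.
Variables (S : {set T}) (e : rel T).
Hypotheses (e_refl : reflexive e) (e_sym : symmetric e).
Hypothesis e_trans : {in S & &, transitive e}.

(** With [e] read as equal or adjacent, [r] is the adjacency matrix plus the identity [D], [l i] is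
    the size of the clique of i, and [W] is the identity minus averaging over cliques. *)
Local Notation r i j := ((e i j)%:R : R).
Local Notation D i j := ((i == j)%:R : R).
Local Notation l i := (#|[set j in S | e i j]|%:R : R).
Local Notation W i j := (D i j - r i j / l i).

Lemma class_size i : \sum_(j in S) r i j = l i.
Proof.
rewrite -sum1_card natr_sum [RHS](eq_bigl (fun j => (j \in S) && e i j)).
  by rewrite big_mkcondr; apply: eq_bigr => j _; case: (e i j).
by move=> j; rewrite inE.
Qed.

Lemma class_size_ge1 i : i \in S -> 1 <= l i.
Proof.
move=> iS; rewrite ler1n card_gt0; apply/set0Pn; exists i.
by rewrite inE iS e_refl.
Qed.

Lemma class_size_eq i j : i \in S -> j \in S -> e i j -> l i = l j.
Proof.
move=> iS jS eij; congr (_%:R); apply: eq_card => k; rewrite !inE.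
case kS: (k \in S) => //=; apply/idP/idP => h.
  by apply: (e_trans iS jS kS) => //; rewrite e_sym.
exact: (e_trans jS iS kS eij h).
Qed.

Lemma class_size_neq0 i : i \in S -> l i != 0.
Proof. by move=> /class_size_ge1 h; rewrite gt_eqF // (lt_le_trans ltr01). Qed.

Lemma sum_diag i (f : T -> R) : i \in S -> \sum_(j in S) D i j * f j = f i.
Proof.
move=> iS; rewrite (bigD1 i) //= eqxx mul1r big1 ?addr0 // => j /andP[_ ji].
by rewrite eq_sym (negPf ji) mul0r.
Qed.

Lemma sum_class i (f : T -> R) : i \in S ->
  (forall j, j \in S -> e i j -> f j = f i) ->
  \sum_(j in S) r i j * f j = l i * f i.
Proof.
move=> iS fE; rewrite -class_size mulr_suml; apply: eq_bigr => j jS.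
by case eij: (e i j); rewrite ?mul0r // fE.
Qed.

(* [W] is the orthogonal projection with kernel the functions constant on
   classes, hence a sum of squares of differences within classes. *)
Lemma sum_clique_proj (B : T -> T -> R) : psd_kernel B ->
  0 <= \sum_(i in S) \sum_(j in S) B i j * W i j.
Proof.
move=> psdB.
pose g i j := r i j / l i * (B i i + B j j - 2 * B i j).
have g0 : 0 <= \sum_(i in S) \sum_(j in S) g i j.
  apply: sumr_ge0 => i iS; apply: sumr_ge0 => j jS.
  by rewrite mulr_ge0 ?psd_kernel_diag2 // divr_ge0 ?ler0n.
have row i : i \in S -> \sum_(j in S) r i j / l i = 1.
  by move=> iS; rewrite -mulr_suml class_size divff ?class_size_neq0.
have s1 : \sum_(i in S) \sum_(j in S) r i j / l i * B i i = \sum_(i in S) B i i.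
  by apply: eq_bigr => i iS; rewrite -mulr_suml row ?mul1r.
have s2 : \sum_(i in S) \sum_(j in S) r i j / l i * B j j = \sum_(i in S) B i i.
  rewrite exchange_big /=; apply: eq_bigr => i iS; rewrite -mulr_suml.
  rewrite (eq_bigr (fun j => r i j / l i)) ?row ?mul1r // => j jS.
  rewrite e_sym; case eij: (e i j); last by rewrite !mul0r.
  by rewrite (class_size_eq iS jS eij).
have s3 : \sum_(i in S) \sum_(j in S) B i j * W i j =
    \sum_(i in S) B i i - \sum_(i in S) \sum_(j in S) r i j / l i * B i j.
  rewrite -sumrB; apply: eq_bigr => i iS.
  rewrite -(sum_diag (fun j => B i j) iS) -sumrB; apply: eq_bigr => j _.
  by ring.
have s4 : \sum_(i in S) \sum_(j in S) g i j =
    2 * \sum_(i in S) \sum_(j in S) B i j * W i j.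
  rewrite s3 mulrBr -[X in X * _](_ : 1 + 1 = 2 :> R) // mulrDl !mul1r.
  rewrite -{1}s1 -s2 mulr_sumr -big_split -sumrB /=; apply: eq_bigr => i _.
  rewrite mulr_sumr -big_split -sumrB /=; apply: eq_bigr => j _.
  by rewrite /g; ring.
by move: g0; rewrite s4; lra.
Qed.

(* [b], [y], [B] are the blocks of a positive semidefinite kernel on the cone.
   The witness [Y] below, with apex column [- t * be], is t z z^T + W for the test
   vector z = (-1, be) of Rayleigh quotient at most [- kap], where [kap ^+ 2] is
   the number of cliques; it is optimal for a complete graph and for a star. *)
Lemma cone_over_cliques (b : R) (y : T -> R) (B : T -> T -> R) :
  psd_kernel B -> (forall c : T -> R,
    0 <= b - 2 * \sum_(i in S) c i * y i
         + \sum_(i in S) \sum_(j in S) c i * c j * B i j) ->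
  #|S|%:R <= b ^+ 2 + 2 * \sum_(i in S) (1 - y i) ^+ 2
    + \sum_(i in S) \sum_(j in S) (r i j - D i j - B i j) ^+ 2.
Proof.
move=> psdB psdv.
have [->|/set0Pn[s0 s0S]] := eqVneq S set0.
  by rewrite cards0 !big_set0 mulr0 !addr0 sqr_ge0.
(* A clique contributes [l i] copies of 1 / [l i], so K counts the cliques. *)
pose K := \sum_(i in S) (l i)^-1; pose kap := Num.sqrt K.
have K1 : 1 <= K.
  have cS : (0 < #|S|%:R :> R) by rewrite ltr0n card_gt0; apply/set0Pn; exists s0.
  rewrite -(@mulfV _ (#|S|%:R : R)) ?gt_eqF // /K -{1}sum1_card natr_sum mulr_suml.
  apply: ler_sum => i iS; rewrite mul1r.
  rewrite lef_pV2 ?posrE //.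
    rewrite ler_nat subset_leq_card //.
    by apply/subsetP => j; rewrite inE => /andP[].
  by rewrite (lt_le_trans ltr01) ?class_size_ge1.
have kap2 : kap ^+ 2 = K by rewrite sqr_sqrtr // (le_trans ler01).
have kap1 : 1 <= kap by rewrite -sqrtr1 ler_wsqrtr.
(* Chosen so that z = (-1, be) satisfies the eigenvalue equation for [- kap] in every row of S: -1 +
   (l - 1) be = - kap be. *)
pose be i := (kap + l i - 1)^-1.
have den i : i \in S -> 0 < kap + l i - 1.
  by move=> /class_size_ge1; lra.
have beE i : i \in S -> (kap + l i - 1) * be i = 1.
  by move=> iS; rewrite mulfV // gt_eqF ?den.
have be_class i j : i \in S -> j \in S -> e i j -> be j = be i.
  by move=> iS jS eij; rewrite /be (class_size_eq iS jS eij).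
(* This bounds the apex row. As (kap - 1)(l - 1) >= 0, be is at least 1 / (kap l), and these sum to
   K / kap = kap. *)
have sbe : kap <= \sum_(i in S) be i.
  have -> : kap = \sum_(i in S) kap^-1 * (l i)^-1.
    rewrite -mulr_sumr -/K -kap2 expr2 mulKf // gt_eqF //; lra.
  apply: ler_sum => i iS; have := class_size_ge1 iS; have := den _ iS.
  move=> d0 ge1; rewrite -invfM lef_pV2 ?posrE //; nra.
(* This t gives t z z^T the Frobenius norm kap. *)
pose Q := \sum_(i in S) be i ^+ 2; pose t := kap / (1 + Q).
have Q0 : 0 <= Q by apply: sumr_ge0 => i _; exact: sqr_ge0.
have tQ : t * (1 + Q) = kap by rewrite /t divfK // gt_eqF //; lra.
have t0 : 0 <= t by rewrite /t divr_ge0 //; lra.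
pose Y i j := t * be i * be j + W i j.
(* [be] is constant on cliques, so the two summands of Y are orthogonal. *)
have sW i : i \in S -> \sum_(j in S) be j * W i j = 0.
  move=> iS.
  rewrite (eq_bigr (fun j => D i j * be j - (r i j * be j) * (l i)^-1)); last first.
    by move=> j _; ring.
  rewrite sumrB -mulr_suml sum_diag // sum_class //; last by move=> j; apply: be_class.
  by rewrite mulrAC mulfV ?class_size_neq0 // mul1r subrr.
have DD i j : D i j * D i j = D i j.
  by case: (i == j); rewrite ?mulr1 ?mulr0.
have rr i j : r i j * r i j = r i j.
  by case: (e i j); rewrite ?mulr1 ?mulr0.
have Dr i j : D i j * r i j = D i j.
  by case: eqP => [<-|]; rewrite ?e_refl ?mulr1 ?mul0r.
have sD i : i \in S -> \sum_(j in S) D i j = 1.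
  by move=> iS; rewrite -[RHS](sum_diag (fun=> 1) iS); apply: eq_bigr => j _; rewrite mulr1.
have sWW i : i \in S -> \sum_(j in S) W i j ^+ 2 = 1 - (l i)^-1.
  move=> iS; have ln := class_size_neq0 iS.
  rewrite (eq_bigr (fun j => D i j * (1 - 2 / l i) + r i j * (l i)^-1 ^+ 2)).
    by rewrite big_split -!mulr_suml /= sD // class_size; field.
  move=> j _.
  have -> : (D i j - r i j / l i) ^+ 2 = D i j * D i j - 2 / l i * (D i j * r i j)
    + r i j * r i j * (l i)^-1 ^+ 2 by ring.
  by rewrite Dr DD rr; ring.
have saW i : i \in S -> \sum_(j in S) (r i j - D i j) * W i j = (l i)^-1 - 1.
  move=> iS; have ln := class_size_neq0 iS.
  rewrite (eq_bigr (fun j => (D i j - r i j) * (l i)^-1)).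
    by rewrite -mulr_suml sumrB sD // class_size; field.
  move=> j _.
  have -> : (r i j - D i j) * (D i j - r i j / l i) =
     D i j * r i j - D i j * D i j - r i j * r i j / l i + D i j * r i j / l i by ring.
  by rewrite Dr DD rr; ring.
have sab i : i \in S ->
    \sum_(j in S) (r i j - D i j) * (be i * be j) = be i - kap * be i ^+ 2.
  move=> iS.
  rewrite (eq_bigr (fun j => (r i j * be j - D i j * be j) * be i)); last by move=> j _; ring.
  rewrite -mulr_suml sumrB sum_diag // sum_class //; last by move=> j; apply: be_class.
  have e1 : (kap + l i - 1) * be i * be i = be i by rewrite beE // mul1r.
  by rewrite -[X in _ = X - _]e1; ring.
have rowY i : i \in S -> \sum_(j in S) (- (2 * (r i j - D i j) * Y i j) - Y i j ^+ 2) =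
   - 2 * t * (be i - kap * be i ^+ 2) + 1 - (l i)^-1 - t ^+ 2 * Q * be i ^+ 2.
  move=> iS.
  rewrite (eq_bigr (fun j => - 2 * t * ((r i j - D i j) * (be i * be j))
    + - 2 * ((r i j - D i j) * W i j) + - W i j ^+ 2 + - 2 * t * be i * (be j * W i j)
    + - t ^+ 2 * be i ^+ 2 * be j ^+ 2)); last by move=> j _; rewrite /Y; ring.
  by rewrite !big_split sumrN -!mulr_sumr /= sab // saW // sWW // sW // -/Q; ring.
(* Entrywise x^2 >= - 2 x y - y^2 with y = Y; [Hy] and [Hb] do the same for the apex column and the
   apex entry. *)
have HB : \sum_(i in S) \sum_(j in S) (- (2 * (r i j - D i j) * Y i j) - Y i j ^+ 2
     + 2 * (B i j * Y i j)) <=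
   \sum_(i in S) \sum_(j in S) (r i j - D i j - B i j) ^+ 2.
  apply: ler_sum => i _; apply: ler_sum => j _.
  have := sqr_ge0 (r i j - D i j - B i j + Y i j); nra.
have HBE : \sum_(i in S) \sum_(j in S) (- (2 * (r i j - D i j) * Y i j) - Y i j ^+ 2
     + 2 * (B i j * Y i j)) =
   (- 2 * t * (\sum_(i in S) be i - kap * Q) + #|S|%:R - K - t ^+ 2 * Q * Q)
   + 2 * t * (\sum_(i in S) \sum_(j in S) be i * be j * B i j)
   + 2 * \sum_(i in S) \sum_(j in S) B i j * W i j.
  have -> : - 2 * t * (\sum_(i in S) be i - kap * Q) + #|S|%:R - K - t ^+ 2 * Q * Q =
     \sum_(i in S) (- 2 * t * (be i - kap * be i ^+ 2) + 1 - (l i)^-1 - t ^+ 2 * Q * be i ^+ 2).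
    rewrite !sumrB big_split /= -!mulr_sumr sumrB -mulr_sumr -/Q -/K.
    by rewrite sumr_const; ring.
  rewrite [X in _ + X + _]mulr_sumr [X in _ + X]mulr_sumr -!big_split /=.
  apply: eq_bigr => i iS; rewrite -rowY //.
  rewrite [X in _ + X + _]mulr_sumr [X in _ + X]mulr_sumr -!big_split /=; apply: eq_bigr => j _.
  by rewrite /Y; ring.
have HW := sum_clique_proj psdB.
have Hy : - 2 * t * (\sum_(i in S) be i * y i) + 2 * t * \sum_(i in S) be i - t ^+ 2 * Q
    <= \sum_(i in S) (1 - y i) ^+ 2.
  rewrite !mulr_sumr -big_split -sumrB /=; apply: ler_sum => i _.
  have := sqr_ge0 (1 - y i - t * be i); nra.
have Hb : 2 * t * b - t ^+ 2 <= b ^+ 2 by have := sqr_ge0 (b - t); nra.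
(* Writing A for the cone, <A, t z z^T> <= - K and <A, W> = K - #|S|, while the squared norms of the
   summands are K and #|S| - K; so - 2 <A, Y> - |Y|^2 >= #|S|. The terms in B are nonnegative by
   [tpsd] and [HW]. *)
have := psdv be => Hpsd.
have tpsd := mulr_ge0 t0 Hpsd.
have tsbe : t * kap <= t * \sum_(i in S) be i by rewrite ler_wpM2l.
have tkap : t * kap + t * kap * Q = K by rewrite -kap2 expr2 -[X in _ = X * _]tQ; ring.
have t2 : t ^+ 2 * (1 + 2 * Q + Q * Q) = K by rewrite -kap2 -tQ; ring.
move: HB; rewrite HBE => HB.
set SB := \sum_(i in S) \sum_(j in S) (_ - B i j) ^+ 2 in HB *.
set X1 := \sum_(i in S) \sum_(j in S) be i * be j * B i j in HB tpsd Hpsd *.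
set X2 := \sum_(i in S) be i * y i in Hy tpsd Hpsd.
set X3 := \sum_(i in S) be i in sbe Hy tsbe HB.
set X4 := \sum_(i in S) (1 - y i) ^+ 2 in Hy *.
set X5 := \sum_(i in S) \sum_(j in S) B i j * W i j in HW HB.
nra.
Qed.

End DisjointCliques.

(** * Blocks with a universal vertex, and their assembly along a dominating set *)

Section Cones.
Context {R : rcfType} {T : finType} (adj : rel T).
Hypotheses (adj_sym : symmetric adj) (adj_irr : irreflexive adj).
Implicit Types (S : {set T}) (v : T) (B : T -> T -> R).

(** The vector c, with sqrt m at v and 1 on S, is the top eigenvector of the star; edges inside S
    only increase its quadratic form. *)
Lemma cone_pos_defect B v S : psd_kernel B -> v \notin S ->
  {in S, forall i, adj v i} ->
  #|S|%:R <= \sum_(i in v |: S) \sum_(j in v |: S) ((adj i j)%:R + B i j) ^+ 2.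
Proof.
move=> psdB vS vadj.
have [->|SN0] := eqVneq S set0.
  by rewrite cards0 !(sumr_ge0, mulr0n) // => i _; rewrite sumr_ge0 // => j _; exact: sqr_ge0.
have m0 : (0 < #|S|%:R :> R) by rewrite ltr0n card_gt0.
set m : R := #|S|%:R in m0 *; pose s := Num.sqrt m.
have s2 : s ^+ 2 = m by rewrite sqr_sqrtr ?ltW.
have s0 : 0 < s by rewrite sqrtr_gt0.
pose c i := if i == v then s else 1.
have cS i : i \in S -> c i = 1.
  by rewrite /c; case: eqP => // -> vin; rewrite vin in vS.
have cv : c v = s by rewrite /c eqxx.
have psd := psd_kernel_in (v |: S) c psdB.
(* Entrywise x^2 >= 2 x y - y^2 with y = c c^T / (2 s), a rank-one matrix of norm s = sqrt m. *)
have main : \sum_(i in v |: S) \sum_(j in v |: S)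
    (s^-1 * (c i * c j * (adj i j)%:R) + s^-1 * (c i * c j * B i j)
     - (s^-1 / 2) ^+ 2 * (c i ^+ 2 * c j ^+ 2)) <=
    \sum_(i in v |: S) \sum_(j in v |: S) ((adj i j)%:R + B i j) ^+ 2.
  apply: ler_sum => i _; apply: ler_sum => j _.
  have := sqr_ge0 ((adj i j)%:R + B i j - s^-1 / 2 * (c i * c j)).
  set x := (adj i j)%:R; set b := B i j; set w := c i * c j; set u := s^-1.
  have -> : c i ^+ 2 * c j ^+ 2 = w ^+ 2 by rewrite /w; ring.
  nra.
apply: le_trans main.
have -> : \sum_(i in v |: S) \sum_(j in v |: S)
    (s^-1 * (c i * c j * (adj i j)%:R) + s^-1 * (c i * c j * B i j)
     - (s^-1 / 2) ^+ 2 * (c i ^+ 2 * c j ^+ 2)) =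
   s^-1 * (\sum_(i in v |: S) \sum_(j in v |: S) c i * c j * (adj i j)%:R)
   + s^-1 * (\sum_(i in v |: S) \sum_(j in v |: S) c i * c j * B i j)
   - (s^-1 / 2) ^+ 2 * (\sum_(i in v |: S) c i ^+ 2) ^+ 2.
  rewrite expr2 [X in _ - _ * X]mulr_suml.
  rewrite [X in _ = X + _ - _]mulr_sumr [X in _ = _ + X - _]mulr_sumr.
  rewrite [X in _ = _ - X]mulr_sumr -big_split -sumrB /=; apply: eq_bigr => i _.
  rewrite [X in _ - _ * X]mulr_sumr.
  rewrite [X in _ = X + _ - _]mulr_sumr [X in _ = _ + X - _]mulr_sumr.
  by rewrite [X in _ = _ - X]mulr_sumr -big_split -sumrB.
have -> : \sum_(i in v |: S) c i ^+ 2 = 2 * m.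
  rewrite big_setU1 //= cv s2 (eq_bigr (fun=> 1)); last by move=> i iS; rewrite cS ?expr1n.
  by rewrite sumr_const -/m; ring.
have adjsum : 2 * s * m <= \sum_(i in v |: S) \sum_(j in v |: S) c i * c j * (adj i j)%:R.
  rewrite sum2_setU1 //; last by move=> i j; rewrite adj_sym [c i * _]mulrC.
  rewrite adj_irr mulr0 add0r (eq_bigr (fun=> s)); last first.
    by move=> j jS; rewrite cv cS ?vadj ?mulr1.
  rewrite sumr_const -[s *+ _]mulr_natr -/m [2 * (s * m)]mulrA lerDl.
  by apply: sumr_ge0 => i iS; apply: sumr_ge0 => j jS; rewrite !cS // !mul1r ler0n.
have u0 : 0 <= s^-1 by rewrite invr_ge0 ltW.
have h1 := ler_wpM2l u0 adjsum; have h2 := mulr_ge0 u0 psd.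
have e1 : s^-1 * (2 * s * m) = 2 * m by field; rewrite gt_eqF.
have e2 : (s^-1 / 2) ^+ 2 * (2 * m) ^+ 2 = m.
  by rewrite -s2; field; rewrite gt_eqF.
by rewrite e2; rewrite e1 in h1; lra.
Qed.

(** The test vector is -1 at v and c on S; this is the positivity hypothesis of
    [cone_over_cliques]. *)
Lemma psd_kernel_schur B v S c : psd_kernel B -> v \notin S ->
  0 <= B v v - 2 * \sum_(i in S) c i * B v i
       + \sum_(i in S) \sum_(j in S) c i * c j * B i j.
Proof.
move=> psdB vS.
have := psd_kernel_in (v |: S) (fun i => if i == v then -1 else c i) psdB.
have inS i : i \in S -> (i == v) = false.
  by move=> iS; apply: contraNF vS => /eqP <-.
rewrite sum2_setU1 //; last by move=> i j; rewrite psdB.1; ring.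
rewrite eqxx mulrNN mulr1 mul1r.
rewrite (eq_bigr (fun i => - (c i * B v i))); last first.
  by move=> i iS; rewrite inS // mulN1r mulNr.
rewrite sumrN mulrN [X in _ + X](eq_bigr (fun i => \sum_(j in S) c i * c j * B i j)) //.
by move=> i iS; apply: eq_bigr => j jS; rewrite !inS.
Qed.

Lemma cone_neg_defect B v S : psd_kernel B -> v \notin S ->
  {in S, forall i, adj v i} ->
  #|S|%:R <= \sum_(i in v |: S) \sum_(j in v |: S) ((adj i j)%:R - B i j) ^+ 2.
Proof.
move=> psdB; have [n] := ubnP #|S|; elim: n S => // n IHn S.
rewrite ltnS => leSn vS vadj.
pose defect i j : R := ((adj i j)%:R - B i j) ^+ 2.
have Fsym i j : defect i j = defect j i by rewrite /defect adj_sym psdB.1.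
have F0 i j : 0 <= defect i j by exact: sqr_ge0.
(* Deleting i keeps the apex and removes the row and column of i; a loss of at least 1 pays for the
   drop of #|S| by one. *)
have drop i j k : i \in S -> j \in S -> k \in S -> i != j -> i != k -> j != k ->
    1 <= B i i ^+ 2 + 2 * (defect i j + defect i k) ->
    #|S|%:R <= \sum_(i in v |: S) \sum_(j in v |: S) defect i j.
  move=> iS jS kS ij ik jk gain.
  have vi : v != i by apply: contraNneq vS => ->.
  have eS : v |: S = i |: (v |: S :\ i).
    by rewrite setUCA setD1K.
  have notin : i \notin v |: S :\ i by rewrite !inE eqxx eq_sym (negPf vi).
  rewrite eS sum2_setU1 //.
  have IH : #|S :\ i|%:R <= \sum_(i0 in v |: S :\ i) \sum_(j0 in v |: S :\ i) defect i0 j0.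
    apply: IHn; first by rewrite (leq_trans _ leSn) // [ltnRHS](cardsD1 i) iS.
      by rewrite !inE negb_and vS orbT.
    by move=> l; rewrite !inE => /andP[_]; apply: vadj.
  have two : defect i j + defect i k <= \sum_(l in v |: S :\ i) defect i l.
    by apply: ge2_sum; rewrite // !inE ?jS ?kS 1?[_ == i]eq_sym ?ij ?ik ?orbT.
  have ii : defect i i = B i i ^+ 2.
    by rewrite /defect adj_irr sub0r sqrrN.
  rewrite (cardsD1 i S) iS add1n -natr1 ii; lra.
have [/existsP[i /existsP[j /existsP[k /and5P[/and3P[iS jS kS] ik ij jk nik]]]]|noP3] :=
  boolP [exists i, exists j, exists k, [&& [&& i \in S, j \in S & k \in S],
    i != k, adj i j, adj j k & ~~ adj i k]].
  have neqadj a b : adj a b -> a != b by apply: contraTneq => ->; rewrite adj_irr.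
  have nij := neqadj _ _ ij; have njk := neqadj _ _ jk.
  have disc s := psd_kernel_path3 s psdB nij njk ik.
  have q0 : 0 <= B j j.
    have := psd_kernel_in [set j] (fun=> 1) psdB.
    by rewrite !big_set1 !mul1r.
  have [g|g|g] := path3_gain disc q0.
  - apply: (drop i j k) => //; rewrite /defect ij (negPf nik) //.
  - apply: (drop j i k) => //; first by rewrite eq_sym.
    by rewrite /defect [adj j i]adj_sym ij jk [B j i]psdB.1.
  - apply: (drop k i j) => //; rewrite 1?eq_sym //.
    rewrite /defect [adj k i]adj_sym [adj k j]adj_sym jk (negPf nik).
    by rewrite [B k i]psdB.1 [B k j]psdB.1.
(* Without induced paths on three vertices in S, equal-or-adjacent is transitive on S. *)
pose e : rel T := fun i j => (i == j) || adj i j.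
have e_refl : reflexive e by move=> i; rewrite /e eqxx.
have e_sym : symmetric e by move=> i j; rewrite /e adj_sym eq_sym.
have e_trans : {in S & &, transitive e}.
  move=> j i k jS iS kS; rewrite /e.
  have [->|ij] := eqVneq i j; first by [].
  have [<-|jk] := eqVneq j k; first by move=> /= ->; rewrite orbT.
  move=> /= aij ajk; have [//|ik] /= := eqVneq i k.
  apply: contraNT noP3 => nik; apply/existsP; exists i; apply/existsP; exists j.
  by apply/existsP; exists k; rewrite iS jS kS ik aij ajk nik.
have schur c := psd_kernel_schur c psdB vS.
have := cone_over_cliques e_refl e_sym e_trans psdB schur.
rewrite sum2_setU1 // adj_irr sub0r sqrrN.
rewrite (eq_bigr (fun i => ((adj v i)%:R - B v i) ^+ 2)); last first.
  by move=> i iS; rewrite vadj.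
move/le_trans; apply; rewrite lerD2l le_eqVlt; apply/orP; left; apply/eqP.
apply: eq_bigr => i _; apply: eq_bigr => j _; rewrite /e.
by have [->|] := eqVneq i j; rewrite ?adj_irr ?subrr ?subr0.
Qed.

Lemma sum_blocks_le (F : T -> T -> R) (g : T -> T) : (forall i j, 0 <= F i j) ->
  \sum_d \sum_(i | g i == d) \sum_(j | g j == d) F i j <= \sum_i \sum_j F i j.
Proof.
move=> F0; rewrite [leRHS](partition_big g xpredT) //=.
apply: ler_sum => d _; apply: ler_sum => i _.
rewrite [leRHS](bigID (fun j => g j == d)) /= lerDl.
by apply: sumr_ge0.
Qed.

(** F is arbitrary so that the lemma serves both |A - B|^2 and |A + B|^2. *)
Lemma domination_defect (F : T -> T -> R) (D : {set T}) :
  (forall i j, 0 <= F i j) -> dominating adj D ->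
  (forall v S, v \notin S -> {in S, forall i, adj v i} ->
     #|S|%:R <= \sum_(i in v |: S) \sum_(j in v |: S) F i j) ->
  #|T|%:R - #|D|%:R <= \sum_i \sum_j F i j.
Proof.
move=> F0 /forallP domD cone.
(* The default of [odflt] is never reached, since D dominates every v outside it. *)
pose g v := if v \in D then v else odflt v [pick u in D | adj v u].
have gD v : g v \in D.
  rewrite /g; case: ifP => // vD; case: pickP => [u /andP[]//|nou].
  have := domD v; rewrite vD /= => /existsP[u uD]; by rewrite nou in uD.
have gadj v : v \notin D -> adj (g v) v.
  move=> vD; rewrite /g (negPf vD); case: pickP => [u /andP[_]|nou].
    by rewrite adj_sym.
  by have := domD v; rewrite (negPf vD) /= => /existsP[u uD]; rewrite nou in uD.
apply: le_trans (sum_blocks_le g F0).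
pose S d := [set v | g v == d] :\: D.
have card : #|T|%:R - #|D|%:R = \sum_(d in D) #|S d|%:R :> R.
  rewrite -(cardsC D) natrD addrAC subrr add0r -sum1_card natr_sum.
  rewrite (partition_big g (mem D)) /=; last by move=> v _; exact: gD.
  apply: eq_bigr => d _; rewrite -sum1_card natr_sum; apply: eq_bigl => v.
  by rewrite !inE.
rewrite card [leLHS]big_mkcond; apply: ler_sum => d _.
case: ifP => dD; last by apply: sumr_ge0 => i _; apply: sumr_ge0.
have dS : d \notin S d by rewrite !inE dD.
(* As g fixes D pointwise, the fibre over d meets D in d alone. *)
have block : [set v | g v == d] = d |: S d.
  apply/setP => v; rewrite !inE; case vD: (v \in D) => /=; last first.
    by case: (eqVneq v d) => // vd; rewrite vd dD in vD.
  by rewrite /g vD orbF.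
have := cone d (S d) dS; rewrite -block => /(_ _)/le_trans; apply.
  by move=> i; rewrite !inE => /andP[iD /eqP <-]; exact: gadj.
rewrite le_eqVlt; apply/orP; left; apply/eqP.
apply: eq_big => [i|i _]; first by rewrite inE.
by apply: eq_bigl => j; rewrite inE.
Qed.

End Cones.

(** * Spectral decomposition of real symmetric matrices *)

Lemma char_poly_conj (F : fieldType) (n : nat) (P A : 'M[F]_n) :
  P \in unitmx -> char_poly (invmx P *m A *m P) = char_poly A.
Proof.
move=> Pu; rewrite /char_poly /char_poly_mx !map_mxM /=.
have PP : map_mx polyC (invmx P) *m map_mx polyC P = 1%:M.
  by rewrite -map_mxM mulVmx // map_mx1.
have -> : 'X%:M - map_mx polyC (invmx P) *m map_mx polyC A *m map_mx polyC P =
    map_mx polyC (invmx P) *m ('X%:M - map_mx polyC A) *m map_mx polyC P.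
  by rewrite mulmxBr mulmxBl scalar_mxC -['X%:M *m _ *m _]mulmxA PP mulmx1.
by rewrite !det_mulmx mulrAC -det_mulmx PP det1 mul1r.
Qed.

Lemma eigenvalues_perm (R : realType) (n : nat) (A : 'M[R]_n) (d : seq R) :
  char_poly A = \prod_(x <- d) ('X - x%:P) -> perm_eq (eigenvalues A) d.
Proof.
move=> cA; apply/allP => x _ /=; rewrite count_eigenvalues cA.
elim: d {cA} => [|y d IHd] /=; first by rewrite big_nil mupNroot // root1.
rewrite big_cons mupM ?polyXsubC_eq0 //; last first.
  by rewrite monic_neq0 // monic_prod_XsubC.
by rewrite -[X in mup _ X]expr1 mup_XsubCX (eqP IHd); case: (y == x).
Qed.

Section Spectral.
Variables (R : realType) (n : nat) (A : 'M[R]_n).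
Hypothesis A_sym : A^T = A.

(** A is diagonalised as a complex Hermitian matrix; its spectrum is real, so real parts in [d] lose
    nothing. *)
Let toC : R -> R[i] := real_complex R.
Let AC : 'M[R[i]]_n := map_mx toC A.
Let U : 'M[R[i]]_n := spectralmx AC.
Let d (k : 'I_n) : R := complex.Re (spectral_diag AC 0 k).

Lemma complexified_hermitian : AC \is hermsymmx.
Proof.
apply: realsym_hermsym.
  apply/is_hermitianmxP; rewrite expr0 scale1r map_mx_id //.
  by rewrite /AC map_trmx A_sym.
by apply/mxOverP => i j; rewrite mxE; apply/complex_realP; exists (A i j).
Qed.

Lemma spectral_diag_re k : spectral_diag AC 0 k = toC (d k).
Proof.
rewrite /d /toC RRe_real //.
exact: (mxOverP (hermitian_spectral_diag_real complexified_hermitian)).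
Qed.

Lemma spectral_decomp : AC = U^t* *m diag_mx (\row_k toC (d k)) *m U.
Proof.
rewrite {1}(orthomx_spectralP (hermitian_normalmx complexified_hermitian)).
rewrite invmx_unitary ?spectral_unitarymx //; congr (_ *m diag_mx _ *m _).
by apply/rowP => k; rewrite !mxE spectral_diag_re.
Qed.

Lemma char_poly_sym : char_poly A = \prod_(x <- [seq d k | k : 'I_n]) ('X - x%:P).
Proof.
apply: (@map_poly_inj _ _ toC); rewrite map_char_poly -/AC spectral_decomp.
rewrite -invmx_unitary ?spectral_unitarymx // char_poly_conj ?spectral_unit //.
rewrite char_poly_trig ?diag_mx_is_trig // rmorph_prod big_image /=.
by apply: eq_bigr => k _; rewrite map_polyXsubC !mxE eqxx mulr1n.
Qed.

(** The real part of the Hermitian matrix with spectrum c in the eigenbasis U, which may be complex;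
    c = d gives back A. *)
Let K (c : 'I_n -> R) i j : R := \sum_k c k *
  (complex.Re (U k i) * complex.Re (U k j) + complex.Im (U k i) * complex.Im (U k j)).

Lemma spectral_kernelE c i j :
  complex.Re ((U^t* *m diag_mx (\row_k toC (c k)) *m U) i j) = K c i j.
Proof.
rewrite mxE raddf_sum /=; apply: eq_bigr => k _.
rewrite mul_mx_diag !mxE; case: (U k i) => a b; case: (U k j) => a' b' /=.
by rewrite /toC /real_complex_def /=; ring.
Qed.

Lemma sym_kernelE i j : A i j = K d i j.
Proof. by rewrite -spectral_kernelE -spectral_decomp mxE. Qed.

Lemma spectral_kernel_psd c : (forall k, 0 <= c k) -> psd_kernel (K c).
Proof.
move=> c0; split=> [i j|w]; first by apply: eq_bigr => k _; ring.
pose a k := \sum_i w i * complex.Re (U k i).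
pose b k := \sum_i w i * complex.Im (U k i).
have -> : \sum_i \sum_j w i * w j * K c i j = \sum_k c k * (a k ^+ 2 + b k ^+ 2).
  under eq_bigr => i _ do under eq_bigr => j _ do rewrite /K mulr_sumr.
  under eq_bigr => i _ do rewrite exchange_big /=.
  rewrite exchange_big /=; apply: eq_bigr => k _.
  rewrite !expr2 /a /b !mulr_suml -big_split mulr_sumr; apply: eq_bigr => i _.
  rewrite !mulr_sumr -big_split mulr_sumr; apply: eq_bigr => j _ /=; ring.
by apply: sumr_ge0 => k _; rewrite mulr_ge0 // addr_ge0 ?sqr_ge0.
Qed.

(** The complex matrix M has squared norm exactly the right-hand side, computed as the trace of M
    M^*; taking real parts can only shrink it. *)
Lemma spectral_kernel_norm c : \sum_i \sum_j K c i j ^+ 2 <= \sum_k c k ^+ 2.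
Proof.
pose M := U^t* *m diag_mx (\row_k toC (c k)) *m U.
have UU : U *m U^t* = 1%:M by apply/unitarymxP; exact: spectral_unitarymx.
have trM : \tr (M *m M^t*) = toC (\sum_k c k ^+ 2).
  have -> : M^t* = M.
    rewrite /M !trmx_mul !map_mxM /= trmxCK tr_diag_mx map_diag_mx mulmxA.
    congr (_ *m diag_mx _ *m _); apply/rowP => k; rewrite !mxE.
    exact: conjc_real.
  rewrite /M !mulmxA mxtrace_mulC !mulmxA UU mul1mx.
  rewrite -[_ *m U *m _]mulmxA UU mulmx1 mulmx_diag mxtrace_diag /toC rmorph_sum.
  by apply: eq_bigr => k _; rewrite !mxE rmorphXn expr2.
have -> : \sum_k c k ^+ 2 = complex.Re (\tr (M *m M^t*)) by rewrite trM.
rewrite /mxtrace raddf_sum /=; apply: ler_sum => i _.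
rewrite mxE raddf_sum /=; apply: ler_sum => j _.
rewrite -spectral_kernelE -/M [M^t* _ _]mxE [M^T _ _]mxE.
case: (M i j) => x y /=.
by rewrite mulrN opprK -expr2 lerDl -expr2 sqr_ge0.
Qed.

Lemma sum_eigenvalues (P : pred R) (f : R -> R) :
  \sum_(x <- eigenvalues A | P x) f x = \sum_(k | P (d k)) f (d k).
Proof.
rewrite (perm_big _ (eigenvalues_perm char_poly_sym)) /=.
by rewrite big_image_cond /=; apply: eq_bigl => k.
Qed.

(** B is the positive part of A, so A - B keeps only the eigenvalues [d k <= 0]. *)
Lemma psd_approx_pos : exists2 B : 'I_n -> 'I_n -> R, psd_kernel B &
  \sum_i \sum_j (A i j - B i j) ^+ 2 <= \sum_(x <- eigenvalues A | x <= 0) x ^+ 2.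
Proof.
exists (K (fun k => if d k <= 0 then 0 else d k)).
  by apply: spectral_kernel_psd => k; case: (lerP (d k) 0) => [_|/ltW].
rewrite (sum_eigenvalues (fun x => x <= 0)) [leRHS]big_mkcond /=.
apply: (le_trans (y := \sum_k (if d k <= 0 then d k else 0) ^+ 2)); last first.
  by apply: ler_sum => k _; case: ifP; rewrite ?expr0n.
apply: le_trans (spectral_kernel_norm _); rewrite le_eqVlt; apply/orP; left.
apply/eqP; apply: eq_bigr => i _; apply: eq_bigr => j _; congr (_ ^+ 2).
rewrite sym_kernelE /K -sumrB; apply: eq_bigr => k _.
by case: ifP => _; ring.
Qed.

(** B is the negative part of A, with its sign reversed. *)
Lemma psd_approx_neg : exists2 B : 'I_n -> 'I_n -> R, psd_kernel B &
  \sum_i \sum_j (A i j + B i j) ^+ 2 <= \sum_(x <- eigenvalues A | 0 <= x) x ^+ 2.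
Proof.
exists (K (fun k => if 0 <= d k then 0 else - d k)).
  by apply: spectral_kernel_psd => k; case: (lerP 0 (d k)) => [_|/ltW]; rewrite ?oppr_ge0.
rewrite (sum_eigenvalues (fun x => 0 <= x)) [leRHS]big_mkcond /=.
apply: (le_trans (y := \sum_k (if 0 <= d k then d k else 0) ^+ 2)); last first.
  by apply: ler_sum => k _; case: ifP; rewrite ?expr0n.
apply: le_trans (spectral_kernel_norm _); rewrite le_eqVlt; apply/orP; left.
apply/eqP; apply: eq_bigr => i _; apply: eq_bigr => j _; congr (_ ^+ 2).
rewrite sym_kernelE /K -big_split; apply: eq_bigr => k _ /=.
by case: ifP => _; ring.
Qed.

End Spectral.

(** * Passage from matrix indices to vertices, and conclusion *)

Lemma sum2_enum_rank (R : nmodType) (T : finType) (F : 'I_#|T| -> 'I_#|T| -> R) :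
  \sum_i \sum_j F i j = \sum_u \sum_v F (enum_rank u) (enum_rank v).
Proof.
rewrite (reindex _ (onW_bij _ (@enum_rank_bij T))); apply: eq_bigr => u _.
by rewrite (reindex _ (onW_bij _ (@enum_rank_bij T))).
Qed.

Lemma psd_kernel_enum_rank (R : numDomainType) (T : finType)
    (B : 'I_#|T| -> 'I_#|T| -> R) :
  psd_kernel B -> psd_kernel (fun u v => B (enum_rank u) (enum_rank v)).
Proof.
case=> Bsym Bpos; split=> [u v|c]; first exact: Bsym.
have := Bpos (fun i => c (enum_val i)); rewrite sum2_enum_rank => /le_trans; apply.
rewrite le_eqVlt; apply/orP; left; apply/eqP.
by apply: eq_bigr => u _; apply: eq_bigr => v _; rewrite !enum_rankK.
Qed.

Unset Implicit Arguments.

Theorem theorem1p3 (R : realType) (T : finType) (adj : rel T)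
    (adj_sym : symmetric adj) (adj_irr : irreflexive adj) :
  Num.min (pos_square_energy R adj) (neg_square_energy R adj)
    >= #|T|%:R - (domination_number adj)%:R.
Proof.
have A_sym : (adjmx R adj)^T = adjmx R adj.
  by apply/matrixP => i j; rewrite !mxE adj_sym.
have [[D domD <-] _] := domination_numberP adj.
rewrite le_min; apply/andP; split.
- have [B psdB Ble] := psd_approx_neg A_sym; apply: le_trans Ble.
  have psdB' := psd_kernel_enum_rank psdB.
  rewrite sum2_enum_rank.
  under eq_bigr => u _ do under eq_bigr => v _ do rewrite mxE !enum_rankK.
  apply: (domination_defect adj_sym _ domD) => [u v|v S vS vadj].
    exact: sqr_ge0.
  exact: (cone_pos_defect adj_sym adj_irr psdB').
- have [B psdB Ble] := psd_approx_pos A_sym; apply: le_trans Ble.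
  have psdB' := psd_kernel_enum_rank psdB.
  rewrite sum2_enum_rank.
  under eq_bigr => u _ do under eq_bigr => v _ do rewrite mxE !enum_rankK.
  apply: (domination_defect adj_sym _ domD) => [u v|v S vS vadj].
    exact: sqr_ge0.
  exact: (cone_neg_defect adj_sym adj_irr psdB').
Qed.
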